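(* Let $n$ be a non-negative integer and let $f_n(x):=\mathrm{lcm}(n)\cdot\binom{x}{n}$ for $x\in\mathbb{Z}$. Then $f_n$ preserves all congruences of $(\mathbb{Z},+)$.
   Context: Here $\mathrm{lcm}(0):=1$ and, for $n\geq 1$, $\mathrm{lcm}(n)$ denotes the least common multiple of $1,\dots,n$. For $x\in\mathbb{Z}$, $\binom{x}{n}:=\frac{x(x-1)\cdots(x-n+1)}{n!}$ (equal to $1$ for $n=0$). The congruences of $(\mathbb{Z},+)$ are the relations $\equiv_r$, $r$ a non-negative integer, where $x\equiv_r y$ iff $x-y$ is a multiple of $r$. A map $f:\mathbb{Z}\to\mathbb{Z}$ preserves $\equiv_r$ if $x\equiv_r y$ implies $f(x)\equiv_r f(y)$. *)

(* Defs.v *)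
From mathcomp Require Import all_boot all_order all_algebra.
From mathcomp Require Import ring.

Set Implicit Arguments.
Unset Strict Implicit.
Unset Printing Implicit Defensive.

Import Order.TTheory GRing.Theory Num.Theory.
Local Open Scope ring_scope.

Definition lcm_upto (n : nat) : nat := (\big[lcmn/1]_(1 <= i < n.+1) i)%N.

(* The division of int is Euclidean, but here it is exact: see binzE. *)
Definition binz (x : int) (n : nat) : int :=
  ((\prod_(0 <= i < n) (x - i%:Z)) %/ (n`!)%:Z)%Z.

Definition lcm_binz (n : nat) (x : int) : int := (lcm_upto n)%:Z * binz x n.

(* For r = 0 this is equality, since 0 divides only 0. *)
Definition congr_mod (r : nat) : rel int := fun x y => (r%:Z %| x - y)%Z.

Definition preserves (f : int -> int) (R : rel int) : Prop :=
  forall x y : int, R x y -> R (f x) (f y).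

Lemma dvdz_fact_prod (n : nat) (x : int) :
  ((n`!)%:Z %| \prod_(0 <= i < n) (x - i%:Z))%Z.
Proof.
elim: n x => [|n IHn] x; first exact: dvd1n.
have pascal (y : int) : \prod_(0 <= i < n.+1) (y + 1 - i%:Z)
    = \prod_(0 <= i < n.+1) (y - i%:Z)
      + n.+1%:Z * \prod_(0 <= i < n) (y - i%:Z).
  rewrite big_nat_recl // big_nat_recr //=.
  rewrite (eq_bigr (fun i : nat => y - i%:Z)) => [|i _]; last first.
    by rewrite intS; ring.
  by rewrite intS; ring.
have step (y : int) :
    ((n.+1)`!%:Z %| n.+1%:Z * \prod_(0 <= i < n) (y - i%:Z))%Z.
  by rewrite factS PoszM dvdz_mul.
elim/int_ind: x => [|m IHm|m IHm].
- by rewrite big_nat_recl // subrr mul0r dvdz0.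
- by rewrite intS addrC pascal rpredD.
- have eq_m : - m%:Z = - m.+1%:Z + 1 by rewrite intS; ring.
  by move: IHm; rewrite eq_m pascal rpredDr.
Qed.

Lemma binzE (x : int) (n : nat) :
  (binz x n)%:~R = (\prod_(0 <= i < n) (x%:~R - i%:R)) / (n`!)%:R :> rat.
Proof.
have nz_fact : (n`!)%:R != 0 :> rat by rewrite pnatr_eq0 -lt0n fact_gt0.
apply: (canRL (mulfK nz_fact)).
rewrite -[(n`!)%:R]/((n`!)%:Z%:~R) -intrM divzK ?dvdz_fact_prod //.
by rewrite rmorph_prod; apply: eq_bigr => i _; rewrite /= rmorphB.
Qed.

(* Main.v *)
(** By Vandermonde's identity, [binz (y + d) n - binz y n] is the sum of
    ['C(d, k) * binz y (n - k)] over [1 <= k <= n].  Since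
    [k * 'C(d, k) = d * 'C(d - 1, k - 1)] and [k] divides [lcm_upto n], each
    term becomes a multiple of [d] once multiplied by [lcm_upto n]. *)

Require Import Defs.
From mathcomp Require Import all_boot all_order all_algebra.
From mathcomp Require Import ring.

Set Implicit Arguments.
Unset Strict Implicit.
Unset Printing Implicit Defensive.

Import Order.TTheory GRing.Theory Num.Theory.

Lemma dvdn_lcm_upto (n k : nat) : 0 < k <= n -> k %| lcm_upto n.
Proof.
move=> k_range; rewrite /lcm_upto (bigD1_seq k) ?iota_uniq //=.
  exact: dvdn_lcml.
by rewrite mem_index_iota ltnS.
Qed.

Lemma dvdn_lcm_upto_bin (n d k : nat) :
  0 < k <= n -> d %| lcm_upto n * 'C(d, k).
Proof.
move=> k_range; have /dvdnP[q ->] := dvdn_lcm_upto k_range.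
(* For [d = 0] the binomial vanishes as [k > 0], leaving 0 dividing 0. *)
case: k d k_range => [|k] [|d] // _; first by rewrite bin0n muln0.
by rewrite -mulnA -mul_bin_diag mulnCA dvdn_mulr.
Qed.

Local Open Scope ring_scope.

Lemma binz0 (x : int) : binz x 0 = 1.
Proof. by rewrite /binz big_nil. Qed.

Lemma binz_fact (x : int) (n : nat) :
  binz x n * (n`!)%:Z = \prod_(0 <= i < n) (x - i%:Z).
Proof. by rewrite divzK ?dvdz_fact_prod. Qed.

Lemma binzS (x : int) (n : nat) :
  binz (x + 1) n.+1 = binz x n.+1 + binz x n.
Proof.
have nz_fact : (n.+1`!)%:Z != 0 by rewrite -lt0n fact_gt0.
(* Cleared of factorials and with P the product of the [x - i] for [i < n], this reads (x + 1) P =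
   (x - n) P + (n + 1) P. *)
apply: (mulIf nz_fact); rewrite mulrDl !binz_fact.
rewrite factS PoszM mulrCA binz_fact big_nat_recl // big_nat_recr //=.
rewrite (eq_bigr (fun i : nat => x - i%:Z)) => [|i _]; last first.
  by rewrite intS; ring.
by rewrite intS; ring.
Qed.

Lemma binz_Vandermonde (y : int) (d n : nat) :
  binz (y + d%:Z) n = \sum_(k < n.+1) 'C(d, k)%:Z * binz y (n - k).
Proof.
elim: d n => [|d IHd] n.
  rewrite addr0 big_ord_recl bin0 mul1r subn0 big1 ?addr0 // => k _.
  by rewrite bin0n mul0r.
case: n => [|n]; first by rewrite big_ord1 !binz0 bin0.
have -> : y + d.+1%:Z = y + d%:Z + 1 by rewrite intS; ring.
(* The terms at [k = 0] agree; the others pair up by Pascal's rule for ['C(d.+1, k.+1)]. *)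
rewrite binzS !IHd big_ord_recl [RHS]big_ord_recl !bin0 -addrA.
congr (_ + _); rewrite -big_split; apply: eq_bigr => k _ /=.
by rewrite /bump /= add1n subSS binS PoszD mulrDl.
Qed.

Lemma dvdz_lcm_binz_sub (n d : nat) (y : int) :
  (d%:Z %| lcm_binz n (y + d%:Z) - lcm_binz n y)%Z.
Proof.
rewrite /lcm_binz -mulrBr binz_Vandermonde big_ord_recl bin0 mul1r subn0.
(* The term at index 0 cancels against [binz y n]; the indices left are [k + 1], between 1 and
   [n]. *)
rewrite addrC addKr mulr_sumr rpred_sum // => k _.
rewrite mulrA -PoszM dvdz_mulr // dvdzE /=.
by rewrite dvdn_lcm_upto_bin //= /bump add1n ltn_ord.
Qed.

Theorem lemma7p7 (n r : nat) : preserves (lcm_binz n) (congr_mod r).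
Proof.
move=> x y; rewrite /congr_mod.
(* Vandermonde needs a natural shift [d]; swapping [x] and [y] only changes signs, which
   divisibility ignores. *)
wlog [d def_x] : x y / exists d : nat, x = y + d%:Z => [th_nonneg|].
  have [le_yx|/ltW le_xy] := lerP y x.
    apply: th_nonneg; exists `|x - y|%N.
    by rewrite gez0_abs ?subr_ge0 // subrKC.
  rewrite -(opprB y) -(opprB (lcm_binz n y)) !rpredN.
  apply: th_nonneg; exists `|y - x|%N.
  by rewrite gez0_abs ?subr_ge0 // subrKC.
(* [r] divides [d], so it suffices that [d] divides the difference of values. *)
rewrite def_x [y + _]addrC addrK addrC => /dvdz_trans; apply.
exact: dvdz_lcm_binz_sub.
Qed.
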